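(* Let $\mathbf{D}\in\mathbb{R}^{m\times n}$, $\mathbf{d}\in\mathbb{R}^m$, $\mathbf{v}\in\mathbb{R}^n$, $\mathbf{W}=\mathrm{diag}(\mathbf{w})\in\mathbb{R}^{n\times n}$ with $\mathbf{v},\mathbf{w}\ge\mathbf{0}$, and let $\overline{\boldsymbol{\Pi}}=\mathrm{diag}(\overline{\boldsymbol{\pi}})$ where $\overline{\boldsymbol{\pi}}\in\mathbb{R}^n$ is a component-wise upper bound on the optimal dual variables $\boldsymbol{\pi}(\mathbf{x},\mathbf{y})$ (in the sense made precise in the context). For $\mathbf{x}\in\{0,1\}^n$ and $\mathbf{y}\in\mathbb{R}^n$ define $$h(\mathbf{x},\mathbf{y})=\max_{\boldsymbol{\xi}\in\mathbb{R}^n}\{\mathbf{y}^\top\boldsymbol{\xi}\mid \mathbf{D}\boldsymbol{\xi}\le\mathbf{d},\ \boldsymbol{\xi}\le\mathbf{v}+\mathbf{W}(\mathbf{e}-\mathbf{x}),\ \boldsymbol{\xi}\ge\mathbf{0}\},$$ $$\bar h(\mathbf{x},\mathbf{y})=\max_{\boldsymbol{\xi},\boldsymbol{\zeta}\in\mathbb{R}^n}\{(\mathbf{y}-\overline{\boldsymbol{\Pi}}\mathbf{x})^\top\boldsymbol{\xi}+\mathbf{y}^\top\boldsymbol{\zeta}\mid \mathbf{D}\boldsymbol{\xi}+\mathbf{D}\boldsymbol{\zeta}\le\mathbf{d},\ \boldsymbol{\xi}\le\mathbf{W}\mathbf{e},\ \boldsymbol{\zeta}\le\mathbf{v},\ \boldsymbol{\xi},\boldsymbol{\zeta}\ge\mathbf{0}\}.$$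 Given a binary $\mathbf{x}\in\{0,1\}^n$, if the set $\{\boldsymbol{\xi}\mid\mathbf{D}\boldsymbol{\xi}\le\mathbf{d},\ \boldsymbol{\xi}\le\mathbf{v}+\mathbf{W}(\mathbf{e}-\mathbf{x}),\ \boldsymbol{\xi}\ge\mathbf{0}\}$ is nonempty, then for all $\mathbf{y}\in\mathcal{Y}$, $$h(\mathbf{x},\mathbf{y})=\bar h(\mathbf{x},\mathbf{y}).$$
   Context: $\mathbf{e}$ is the vector of ones; vector inequalities are component-wise; $\mathrm{diag}(\cdot)$ is the diagonal matrix with the given diagonal. $\mathcal{Y}\subseteq\mathbb{R}^n$ is the set of vectors $\mathbf{y}$ under consideration (those allowed in the overall optimization problem). $\boldsymbol{\pi}(\mathbf{x},\mathbf{y})$ denotes the $\boldsymbol{\pi}$-part of an optimal solution of the linear programming dual of the problem defining $h(\mathbf{x},\mathbf{y})$, $$\min_{\boldsymbol{\pi},\mathbf{q}}\{\mathbf{q}^\top\mathbf{d}+\boldsymbol{\pi}^\top\mathbf{v}+\boldsymbol{\pi}^\top\mathbf{W}(\mathbf{e}-\mathbf{x})\mid \boldsymbol{\pi}^\top+\mathbf{q}^\top\mathbf{D}\ge\mathbf{y}^\top,\ \boldsymbol{\pi},\mathbf{q}\ge\mathbf{0}\},$$ i.e. the dual variable of the constraint $\boldsymbol{\xi}\le\mathbf{v}+\mathbf{W}(\mathbf{e}-\mathbf{x})$. The standing assumption on $\overline{\boldsymbol{\pi}}$ is: for every $\mathbf{x}\in\{0,1\}^n$ for which the problem defining $h$ is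 feasible and every $\mathbf{y}\in\mathcal{Y}$, there is an optimal dual solution with $\boldsymbol{\pi}(\mathbf{x},\mathbf{y})\le\overline{\boldsymbol{\pi}}$ component-wise. *)

(* Defs.v *)
From mathcomp Require Import all_boot all_order all_algebra.
From mathcomp Require Import classical_sets reals.

Set Implicit Arguments.
Unset Strict Implicit.
Unset Printing Implicit Defensive.

Import Order.TTheory GRing.Theory Num.Theory.
Local Open Scope classical_set_scope.
Local Open Scope ring_scope.

Definition mxle (R : realType) (p q : nat) (A B : 'M[R]_(p, q)) : Prop :=
  forall i j, A i j <= B i j.

Definition dot (R : realType) (n : nat) (u v : 'cV[R]_n) : R :=
  (u^T *m v) 0 0.

Definition ones (R : realType) (n : nat) : 'cV[R]_n := const_mx 1.

Definition is_binary (R : realType) (n : nat) (x : 'cV[R]_n) : Prop :=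
  forall i, x i 0 = 0 \/ x i 0 = 1.

Definition is_max (R : realType) (S : set R) (z : R) : Prop :=
  S z /\ ubound S z.

(* The value is 0 when S has no maximum, so an equation between two values of
   max_of is only meaningful together with the attainment statement is_max. *)
Definition max_of (R : realType) (S : set R) : R := xget 0 (is_max S).

Section Problems.
Variables (R : realType) (m n : nat).
Variables (D : 'M[R]_(m, n)) (d : 'cV[R]_m) (v : 'cV[R]_n) (W : 'M[R]_n).

Definition h_feasible (x : 'cV[R]_n) : set 'cV[R]_n :=
  [set xi | [/\ mxle (D *m xi) d, mxle xi (v + W *m (ones R n - x))
              & mxle 0 xi]].

Definition h_values (x y : 'cV[R]_n) : set R :=
  [set dot y xi | xi in h_feasible x].

Definition h (x y : 'cV[R]_n) : R := max_of (h_values x y).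

Definition hbar_feasible : set ('cV[R]_n * 'cV[R]_n) :=
  [set p | let: (xi, zeta) := p in
     [/\ mxle (D *m xi + D *m zeta) d, mxle xi (W *m ones R n), mxle zeta v,
         mxle 0 xi & mxle 0 zeta]].

Definition hbar_values (Pibar : 'M[R]_n) (x y : 'cV[R]_n) : set R :=
  [set dot (y - Pibar *m x) p.1 + dot y p.2 | p in hbar_feasible].

Definition hbar (Pibar : 'M[R]_n) (x y : 'cV[R]_n) : R :=
  max_of (hbar_values Pibar x y).

Definition dual_feasible (y pi : 'cV[R]_n) (q : 'cV[R]_m) : Prop :=
  [/\ mxle y^T (pi^T + q^T *m D), mxle 0 pi & mxle 0 q].

Definition dual_objective (x pi : 'cV[R]_n) (q : 'cV[R]_m) : R :=
  dot q d + dot pi v + dot pi (W *m (ones R n - x)).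

Definition dual_optimal (x y pi : 'cV[R]_n) (q : 'cV[R]_m) : Prop :=
  dual_feasible y pi q /\
  forall pi' q', dual_feasible y pi' q' ->
    dual_objective x pi q <= dual_objective x pi' q'.

(* The optimal dual solution need not be unique: the bound is only required
   of one optimal solution for each pair (x, y). *)
Definition dual_upper_bound (Y : set 'cV[R]_n) (pibar : 'cV[R]_n) : Prop :=
  forall x y, is_binary x -> h_feasible x !=set0 -> Y y ->
    exists pi q, dual_optimal x y pi q /\ mxle pi pibar.

End Problems.

(* Main.v *)
(** For any feasible [(xi, zeta)] of the relaxed problem and any optimal dual
    solution [(pi, q)] with [pi <= pibar], weak duality together with
    [(pi - pibar)^T diag(x) xi <= 0] bounds the relaxed objective by the dual optimum.
    Conversely an optimal [xi] of the problem defining [h] splits as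
    [(xi - min xi v) + min xi v], whose first part vanishes wherever [x = 1], so
    the penalty disappears and the dual optimum is attained in both problems.
    Strong duality is derived from Farkas' lemma, which is proved by
    Fourier-Motzkin elimination. *)
Require Import Defs.
From mathcomp Require Import all_boot all_order all_algebra.
From mathcomp Require Import classical_sets reals.
From mathcomp Require Import ring lra.

Set Implicit Arguments.
Unset Strict Implicit.
Unset Printing Implicit Defensive.

Import Order.TTheory GRing.Theory Num.Theory.
Local Open Scope classical_set_scope.
Local Open Scope ring_scope.

(** * Fourier-Motzkin elimination and Farkas' lemma for families *)

(** Rows with [0 < p i] bound [t] above by [s i / p i], rows with [p j < 0] bound it below by
    [s j / p j]. The pairwise hypothesis says that no lower bound exceeds an upper one, so the least
    upper bound works, or the greatest lower bound when no row bounds [t] above. *)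
Lemma linear_system1_solvable (R : realFieldType) (I : finType) (p s : I -> R) :
  (forall i, p i = 0 -> 0 <= s i) ->
  (forall i j, 0 < p i -> p j < 0 -> 0 <= - p j * s i + p i * s j) ->
  exists t, forall i, p i * t <= s i.
Proof.
move=> s0 spn.
have [i0 p0|nopos] := pickP (fun i => 0 < p i).
  have [i pi0 imin] :=
    @arg_minP _ _ _ i0 (fun i => 0 < p i) (fun i => s i / p i) p0.
  exists (s i / p i) => j.
  have [pj|pj|pj] := ltgtP (p j) 0.
  - have := spn i j pi0 pj => h.
    rewrite mulrA ler_pdivrMr //; lra.
  - by rewrite mulrC -ler_pdivlMr //; apply: imin.
  - by rewrite pj mul0r; apply: s0.
have [j0 p0|noneg] := pickP (fun j => p j < 0).
  have [j pj0 jmax] :=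
    @arg_maxP _ _ _ j0 (fun j => p j < 0) (fun j => s j / p j) p0.
  exists (s j / p j) => i.
  have [pi|pi|pi] := ltgtP (p i) 0.
  - by rewrite mulrC -ler_ndivrMr //; apply: jmax.
  - by have := nopos i; rewrite pi.
  - by rewrite pi mul0r; apply: s0.
exists 0 => i; rewrite mulr0; apply: s0.
by have [pi|pi|//] := ltgtP (p i) 0; [have := noneg i|have := nopos i]; rewrite pi.
Qed.

(** Induction on the number of variables: the variable [ord0] is eliminated, and either a solution
    of the smaller system extends to [ord0] or its infeasibility certificate pulls back. *)
Lemma farkas_family (R : realFieldType) (n : nat) (I : finType)
    (a : I -> 'I_n -> R) (b : I -> R) :
  (exists x : 'I_n -> R, forall i, \sum_k a i k * x k <= b i) \/
  (exists u : I -> R, [/\ forall i, 0 <= u i,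
     forall k, \sum_i u i * a i k = 0 & \sum_i u i * b i < 0]).
Proof.
elim: n I a b => [|n IHn] I a b.
  have [i bi|bge0] := pickP (fun i => b i < 0).
    right; exists (fun j => (j == i)%:R); split.
    - by move=> j; rewrite ler0n.
    - by case.
    - rewrite (bigD1 i) //= eqxx mul1r big1 ?addr0 // => j /negPf ->.
      by rewrite mul0r.
  left; exists (fun=> 0) => i.
  by rewrite big_ord0 leNgt bge0.
(* Pairs [(i, j)] that are not to be combined get zero multipliers, so that the
   eliminated system can be indexed by all of [I * I]. *)
pose p i := a i ord0.
pose al (ij : I * I) : R :=
  if (0 < p ij.1) && (p ij.2 < 0) then - p ij.2 else (p ij.1 == 0)%:R.
pose be (ij : I * I) : R := if (0 < p ij.1) && (p ij.2 < 0) then p ij.1 else 0.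
have al_ge0 ij : 0 <= al ij.
  by rewrite /al; case: ifP => [/andP[_ h]|_]; [lra|rewrite ler0n].
have be_ge0 ij : 0 <= be ij.
  by rewrite /be; case: ifP => [/andP[h _]|//]; lra.
have elim0 ij : al ij * p ij.1 + be ij * p ij.2 = 0.
  rewrite /al /be; case: ifP => _; first ring.
  by case: eqP => [->|_]; rewrite ?mulr0 !mul0r addr0.
pose comb (f : I -> R) ij := al ij * f ij.1 + be ij * f ij.2.
have [[x hx]|[u [u_ge0 ua0 ub]]] :=
  IHn _ (fun ij k => comb (a ^~ (lift ord0 k)) ij) (comb b).
(* With the other variables fixed to [x], [s i] is what row [i] leaves for the term [p i * t]. *)
- pose s i := b i - \sum_k a i (lift ord0 k) * x k.
  have scomb ij : 0 <= comb s ij.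
    have := hx ij; rewrite /comb /s !mulrBr /= => h.
    suff e : \sum_k (al ij * a ij.1 (lift ord0 k) +
                     be ij * a ij.2 (lift ord0 k)) * x k =
        al ij * (\sum_k a ij.1 (lift ord0 k) * x k) +
        be ij * (\sum_k a ij.2 (lift ord0 k) * x k) by rewrite e in h; lra.
    rewrite !mulr_sumr -big_split /=; apply: eq_bigr => k _; ring.
  have [|i j pi pj|t ht] := @linear_system1_solvable _ I p s.
  (* When [p i = 0], the diagonal pair [(i, i)] reproduces row [i] itself. *)
  + move=> i pi; have := scomb (i, i).
    by rewrite /comb /al /be /= pi ltxx eqxx /= mul1r mul0r addr0.
  + have := scomb (i, j); by rewrite /comb /al /be /= pi pj.
  left; exists (fun k => if unlift ord0 k is Some k' then x k' else t) => i.
  rewrite big_ord_recl unlift_none.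
  under eq_bigr do rewrite liftK.
  have := ht i; rewrite /s /p; lra.
(* The weight [u ij] of a combined row is passed back to its two parent rows, scaled by [al ij] and
   [be ij]. *)
- right; pose u' i := \sum_(ij : I * I) u ij *
      (al ij * (ij.1 == i)%:R + be ij * (ij.2 == i)%:R).
  have pick1 (f : I -> R) j : \sum_i (j == i)%:R * f i = f j.
    rewrite (bigD1 j) //= eqxx mul1r big1 ?addr0 // => i.
    by rewrite eq_sym => /negPf ->; rewrite mul0r.
  have u'E f : \sum_i u' i * f i = \sum_ij u ij * comb f ij.
    rewrite /u'; under eq_bigr do rewrite mulr_suml.
    rewrite exchange_big /=; apply: eq_bigr => ij _.
    rewrite /comb -[f ij.1]pick1 -[f ij.2]pick1.
    rewrite !mulr_sumr -big_split /= mulr_sumr.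
    apply: eq_bigr => i _; ring.
  exists u'; split.
  + move=> i; apply: sumr_ge0 => ij _; apply: mulr_ge0 => //.
    by rewrite addr_ge0 // mulr_ge0.
  + move=> k; rewrite (u'E (a ^~ k)).
    have [k' ->|->] := unliftP ord0 k; first exact: ua0.
    by rewrite big1 // => ij _; rewrite /comb elim0 mulr0.
  + by rewrite u'E.
Qed.

(** * Matrix form of Farkas' lemma and linear programming duality *)

Section Duality.
Variable R : realType.

Lemma mxle_col p1 p2 q (A1 B1 : 'M[R]_(p1, q)) (A2 B2 : 'M[R]_(p2, q)) :
  mxle (col_mx A1 A2) (col_mx B1 B2) <-> mxle A1 B1 /\ mxle A2 B2.
Proof.
split=> [AB|[AB1 AB2] i j].
  split=> i j; first by have := AB (lshift _ i) j; rewrite !col_mxEu.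
  by have := AB (rshift _ i) j; rewrite !col_mxEd.
by rewrite !mxE; case: splitP => k _.
Qed.

Lemma mxle_col0 p1 p2 q (A1 : 'M[R]_(p1, q)) (A2 : 'M[R]_(p2, q)) :
  mxle 0 (col_mx A1 A2) <-> mxle 0 A1 /\ mxle 0 A2.
Proof. by rewrite -col_mx0; apply: mxle_col. Qed.

Lemma dotE n (u z : 'cV[R]_n) : dot u z = \sum_i u i 0 * z i 0.
Proof. by rewrite /dot mxE; apply: eq_bigr => i _; rewrite mxE. Qed.

Lemma dotC n (u z : 'cV[R]_n) : dot u z = dot z u.
Proof. by rewrite !dotE; apply: eq_bigr => i _; rewrite mulrC. Qed.

Lemma dotDl n (u1 u2 z : 'cV[R]_n) : dot (u1 + u2) z = dot u1 z + dot u2 z.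
Proof. by rewrite /dot linearD mulmxDl mxE. Qed.

Lemma dotDr n (z u1 u2 : 'cV[R]_n) : dot z (u1 + u2) = dot z u1 + dot z u2.
Proof. by rewrite /dot mulmxDr mxE. Qed.

Lemma dotZl n c (u z : 'cV[R]_n) : dot (c *: u) z = c * dot u z.
Proof. by rewrite /dot linearZ -scalemxAl mxE. Qed.

Lemma dot_col p q (u1 z1 : 'cV[R]_p) (u2 z2 : 'cV[R]_q) :
  dot (col_mx u1 u2) (col_mx z1 z2) = dot u1 z1 + dot u2 z2.
Proof. by rewrite /dot tr_col_mx mul_row_col mxE. Qed.

Lemma dot_mulmx p q (u : 'cV[R]_p) (A : 'M[R]_(p, q)) (z : 'cV[R]_q) :
  dot u (A *m z) = dot (A^T *m u) z.
Proof. by rewrite /dot trmx_mul trmxK mulmxA. Qed.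

Lemma ler_dot n (z u1 u2 : 'cV[R]_n) :
  mxle 0 z -> mxle u1 u2 -> dot z u1 <= dot z u2.
Proof.
move=> z0 u12; rewrite !dotE; apply: ler_sum => i _; apply: ler_wpM2l => //.
by have := z0 i 0; rewrite mxE.
Qed.

Lemma farkas k n (A : 'M[R]_(k, n)) (b : 'cV[R]_k) :
  (exists x : 'cV[R]_n, mxle (A *m x) b) \/
  (exists u : 'cV[R]_k, [/\ mxle 0 u, A^T *m u = 0 & dot u b < 0]).
Proof.
have [[x hx]|[u [u0 uA ub]]] := farkas_family A (b ^~ 0).
  left; exists (\col_i x i) => i j; rewrite (ord1 j) mxE.
  by under eq_bigr do rewrite mxE.
right; exists (\col_i u i); split.
- by move=> i j; rewrite !mxE.
- apply/matrixP => i j; rewrite !mxE -[RHS](uA i).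
  by apply: eq_bigr => l _; rewrite !mxE mulrC.
- by rewrite dotE; under eq_bigr do rewrite mxE.
Qed.

(** The sign constraints are appended as rows [- x <= 0]; their multipliers [u2] equal [A^T *m u1],
    which is therefore nonnegative. *)
Lemma farkas_nonneg k n (A : 'M[R]_(k, n)) (b : 'cV[R]_k) :
  (exists x : 'cV[R]_n, mxle 0 x /\ mxle (A *m x) b) \/
  (exists u : 'cV[R]_k, [/\ mxle 0 u, mxle 0 (A^T *m u) & dot u b < 0]).
Proof.
have [[x]|[u]] := farkas (col_mx A (- 1%:M)) (col_mx b 0).
  rewrite mul_col_mx => /mxle_col[Ax]; rewrite mulNmx mul1mx => x0.
  by left; exists x; split=> // i j; have := x0 i j; rewrite !mxE; lra.
rewrite -[u]vsubmxK; move: (usubmx u) (dsubmx u) => u1 u2.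
move=> [/mxle_col0[u10 u20]].
rewrite tr_col_mx mul_row_col linearN /= trmx1 mulNmx mul1mx => /eqP.
rewrite subr_eq0 => /eqP eu; rewrite dot_col [dot u2 0]/dot mulmx0 mxE addr0.
by move=> ub; right; exists u1; split=> //; rewrite eu.
Qed.

Lemma lp_strong_duality k n (A : 'M[R]_(k, n)) (b z : 'cV[R]_k) (c : 'cV[R]_n) :
  mxle 0 z -> mxle c (A^T *m z) ->
  (forall z', mxle 0 z' -> mxle c (A^T *m z') -> dot z b <= dot z' b) ->
  exists x, [/\ mxle 0 x, mxle (A *m x) b & dot z b <= dot c x].
Proof.
move=> z0 cz zmin.
(* The extra row asks that [dot c x] reach [dot z b]. The alternative gives [u1 >= 0] and [t >= 0]
   with [A^T *m u1 >= t *: c] and [dot u1 b < t * dot z b], which contradicts the optimality of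
   [z]. *)
have [[x [x0]]|[u]] :=
  farkas_nonneg (col_mx A (- c^T)) (col_mx b (- (dot z b)%:M)).
  rewrite mul_col_mx => /mxle_col[Ax cx].
  exists x; split=> //.
  have := cx 0 0; rewrite mulNmx [in X in X -> _]mxE.
  by rewrite [leRHS]mxE [X in _ <= - X]mxE lerN2.
rewrite -[u]vsubmxK; move: (usubmx u) (dsubmx u) => u1 t.
move=> [/mxle_col0[u10 t0]].
have -> : t = (t 0 0)%:M by apply/matrixP => i j; rewrite !ord1 [RHS]mxE mulr1n.
have {t0} := t0 0 0; rewrite mxE; move: (t 0 0) => {}t t0.
rewrite tr_col_mx mul_row_col linearN /= trmxK mulNmx mul_mx_scalar => uA.
rewrite dot_col [dot t%:M _]dotE big_ord1 !mxE !mulr1n mulrN => ub.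
exfalso; have [tpos|tneg] := ltP 0 t.
  (* [u1 / t] is a better dual solution. *)
  have := zmin (t^-1 *: u1); rewrite dotZl => h.
  suff : dot z b <= t^-1 * dot u1 b by rewrite mulrC ler_pdivlMr //; lra.
  apply: h => i j.
    by have := u10 i j; rewrite !mxE => h; rewrite mulr_ge0 // invr_ge0 ltW.
  have := uA i j; rewrite -scalemxAr !mxE => h.
  by rewrite mulrC ler_pdivlMr //; lra.
(* [u1] is a direction along which the dual objective decreases. *)
have t00 : t = 0 by lra.
have := zmin (z + u1); rewrite dotDl => h.
suff : dot z b <= dot z b + dot u1 b by rewrite t00 in ub; lra.
apply: h => i j.
  by have := z0 i j; have := u10 i j; rewrite !mxE; lra.
have := uA i j; have := cz i j; rewrite t00 scale0r oppr0 addr0 mulmxDr => h1.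
rewrite [X in X <= _]mxE => h2; rewrite [leRHS]mxE; lra.
Qed.

Lemma max_ofP (S : set R) (z : R) : is_max S z -> max_of S = z.
Proof.
move=> [Sz ubz]; rewrite /max_of; case: xgetP => [y _ [Sy uby]|/(_ z)[]//].
by apply/le_anti/andP; split; [apply: ubz|apply: uby].
Qed.

End Duality.

(** * Equality of the two maxima *)

Theorem proposition1 (R : realType) (m n : nat)
    (D : 'M[R]_(m, n)) (d : 'cV[R]_m) (v w pibar : 'cV[R]_n)
    (Y : set 'cV[R]_n)
    (hv : mxle 0 v) (hw : mxle 0 w)
    (hpibar : dual_upper_bound D d v (diag_mx w^T) Y pibar)
    (x : 'cV[R]_n) (hx : is_binary x)
    (hfeas : h_feasible D d v (diag_mx w^T) x !=set0) :
  forall y : 'cV[R]_n, Y y ->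
    [/\ is_max (h_values D d v (diag_mx w^T) x y)
               (h D d v (diag_mx w^T) x y),
        is_max (hbar_values D d v (diag_mx w^T) (diag_mx pibar^T) x y)
               (hbar D d v (diag_mx w^T) (diag_mx pibar^T) x y)
      & h D d v (diag_mx w^T) x y
        = hbar D d v (diag_mx w^T) (diag_mx pibar^T) x y].
Proof.
move=> y Yy.
have [pi [q [[[yle pi0 q0] dmin] pile]]] := hpibar x y hx hfeas Yy.
set W := diag_mx w^T in hpibar hfeas dmin *.
have W1 i (z : 'cV[R]_n) : (W *m z) i 0 = w i 0 * z i 0.
  by rewrite /W mul_diag_mx !mxE.
have P1 i (z : 'cV[R]_n) : (diag_mx pibar^T *m z) i 0 = pibar i 0 * z i 0.
  by rewrite mul_diag_mx !mxE.
have UE i : (v + W *m (ones R n - x)) i 0 = v i 0 + w i 0 * (1 - x i 0).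
  by rewrite mxE W1 !mxE.
have PE i : (y - diag_mx pibar^T *m x) i 0 = y i 0 - pibar i 0 * x i 0.
  by rewrite mxE [X in _ + X]mxE P1.
set val := dual_objective d v W x pi q in dmin.
(* Stacking [pi] over [q] and the identity over [D] puts the dual in the form of
   [lp_strong_duality]. *)
have ob_col pi' q' : dual_objective d v W x pi' q' =
    dot (col_mx pi' q') (col_mx (v + W *m (ones R n - x)) d).
  by rewrite dot_col dotDr /dual_objective; ring.
have dual_col (pi' : 'cV[R]_n) (q' : 'cV[R]_m) :
    (col_mx 1%:M D)^T *m col_mx pi' q' = (pi'^T + q'^T *m D)^T.
  by rewrite tr_col_mx mul_row_col trmx1 mul1mx linearD /= trmx_mul !trmxK.
have yle' : mxle y (pi + D^T *m q).
  by move=> i j; have := yle j i; rewrite -[q^T *m D]trmxK trmx_mul trmxK !mxE.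
have [xi [xi0 xile xival]] : exists xi, [/\ mxle 0 xi,
    mxle (col_mx 1%:M D *m xi) (col_mx (v + W *m (ones R n - x)) d)
    & val <= dot y xi].
  rewrite /val ob_col; apply: lp_strong_duality.
  - exact/mxle_col0.
  - by rewrite dual_col => i j; have := yle j i; rewrite !mxE.
  move=> z'; rewrite -[z']vsubmxK -ob_col dual_col => /mxle_col0[z1 z2] yz.
  rewrite -ob_col; apply: dmin; split=> // i j.
  by have := yz j i; rewrite !mxE.
move: xile; rewrite mul_col_mx mul1mx => /mxle_col[xiu xid].
have entry (a b : 'cV[R]_n) : mxle a b -> forall i, a i 0 <= b i 0 by move=> h i.
have weak xi' zeta : hbar_feasible D d v W (xi', zeta) ->
    dot (y - diag_mx pibar^T *m x) xi' + dot y zeta <= val.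
  move=> [hD hxi hz xi'0 z0].
  have s0 : mxle 0 (xi' + zeta).
    by move=> i j; have := xi'0 i j; have := z0 i j; rewrite !mxE; lra.
  have le1 := ler_dot s0 yle'.
  rewrite -mulmxDr in hD; have := ler_dot q0 hD; rewrite dot_mulmx => le2.
  rewrite !(dotC (xi' + zeta)) dotDl in le1.
  (* Entrywise: for [x i 0 = 0] this follows from [xi' <= w] and [zeta <= v]; for [x i 0 = 1] the
     penalty absorbs [pi * xi'] because [pi <= pibar]. *)
  have le3 : dot pi (xi' + zeta) - dot (diag_mx pibar^T *m x) xi' <=
      dot pi (v + W *m (ones R n - x)).
    rewrite !dotE -sumrB; apply: ler_sum => i _.
    rewrite UE P1 [X in _ * X - _]mxE.
    have := entry _ _ hxi i; have := entry _ _ hz i; have := entry _ _ xi'0 i.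
    have := entry _ _ pi0 i; have := entry _ _ pile i.
    rewrite W1 !mxE => h1 h2 h3 h4 h5.
    by case: (hx i) => ->; nra.
  have le4 : dot (y - diag_mx pibar^T *m x) xi' =
      dot y xi' - dot (diag_mx pibar^T *m x) xi'.
    by rewrite dotDl -scaleN1r dotZl mulN1r.
  move: le1 le2 le3; rewrite le4 /val /dual_objective !dotDr; lra.
have emb xi' : h_feasible D d v W x xi' ->
    hbar_values D d v W (diag_mx pibar^T) x y (dot y xi').
  move=> [hD hu h0].
  pose zeta := \col_i Num.min (xi' i 0) (v i 0).
  exists (xi' - zeta, zeta).
    split=> /=.
    - by rewrite -mulmxDr subrK.
    (* The excess of [xi'] over [v] is at most [w] where [x] is 0, and there is none where [x] is
       1. *)
    - move=> i j; rewrite (ord1 j) W1; have := entry _ _ hu i.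
      rewrite UE !mxE; have := entry _ _ hw i; rewrite mxE => wi.
      by case: (hx i) => ->; rewrite minEle; case: ifP => /=; lra.
    - by move=> i j; rewrite (ord1 j) mxE ge_min lexx orbT.
    - by move=> i j; rewrite (ord1 j) !mxE subr_ge0 ge_min lexx.
    - move=> i j; rewrite (ord1 j) !mxE le_min.
      have := entry _ _ h0 i; have := entry _ _ hv i; rewrite !mxE.
      by move=> -> ->.
  rewrite /= !dotE -big_split /=; apply: eq_bigr => i _.
  have := entry _ _ hu i; rewrite PE UE !mxE.
  case: (hx i) => ->; first by move=> _; ring.
  by rewrite subrr mulr0 addr0 => /min_idPl ->; ring.
have hfx : h_feasible D d v W x xi by [].
(* The upper bound passes through [emb], so the single inequality [weak] serves both problems. *)
have xiE : dot y xi = val.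
  apply/le_anti; rewrite xival andbT.
  by have [[xi' zeta] /weak /= h <-] := emb _ hfx.
have max1 : is_max (h_values D d v W x y) val.
  split; first by exists xi.
  by move=> _ [xi' /emb[[xi1 z1] /weak /= h <-] <-].
have max2 : is_max (hbar_values D d v W (diag_mx pibar^T) x y) val.
  split; first by rewrite -xiE; apply: emb.
  by move=> _ [[xi1 z1] /weak h <-].
by rewrite /h /hbar (max_ofP max1) (max_ofP max2).
Qed.
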